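(* Every MV-algebra $A$ with product defined by the infimum, $x\cdot y=x\wedge y$, is an $MVW$-rig.
   Context: An MV-algebra is $(A,\oplus,\neg,0)$ with $(A,\oplus,0)$ a commutative monoid, $\neg\neg x=x$, $x\oplus\neg 0=\neg 0$, $\neg(\neg x\oplus y)\oplus y=\neg(\neg y\oplus x)\oplus x$. Put $x\ominus y=\neg(\neg x\oplus y)$; $A$ is a lattice under the order $x\le y\iff x\ominus y=0$, and $\wedge$ is its meet. An $MVW$-rig is an MV-algebra with an associative commutative product such that for all $a,b,c$: $a0=0a=0$; $a(b\oplus c)\le ab\oplus ac$; $ab\ominus ac\le a(b\ominus c)$. *)

(* Defs.v *)
From mathcomp Require Import ssreflect ssrfun ssrbool.

Set Implicit Arguments.
Unset Strict Implicit.
Unset Printing Implicit Defensive.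

Declare Scope mv_scope.
Delimit Scope mv_scope with mv.
Local Open Scope mv_scope.

Record mvAlgebra := MVAlgebra {
  mv_sort :> Type;
  mv_add : mv_sort -> mv_sort -> mv_sort;
  mv_neg : mv_sort -> mv_sort;
  mv_zero : mv_sort;
  mv_addA : forall x y z,
    mv_add x (mv_add y z) = mv_add (mv_add x y) z;
  mv_addC : forall x y, mv_add x y = mv_add y x;
  mv_addx0 : forall x, mv_add x mv_zero = x;
  mv_negK : forall x, mv_neg (mv_neg x) = x;
  mv_addx1 : forall x, mv_add x (mv_neg mv_zero) = mv_neg mv_zero;
  mv_lukasiewicz : forall x y,
    mv_add (mv_neg (mv_add (mv_neg x) y)) y =
    mv_add (mv_neg (mv_add (mv_neg y) x)) x }.

Arguments mv_zero {m}.

Notation "x ⊕ y" := (mv_add x y) (at level 50, left associativity) : mv_scope.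
Notation "¬ x" := (mv_neg x) (at level 35, right associativity) : mv_scope.
Notation "0" := mv_zero : mv_scope.

Definition mv_sub (A : mvAlgebra) (x y : A) : A := ¬ (¬ x ⊕ y).
Notation "x ⊖ y" := (mv_sub x y) (at level 50, left associativity) : mv_scope.

Definition mv_le (A : mvAlgebra) (x y : A) : Prop := x ⊖ y = 0.
Notation "x ≤ y" := (mv_le x y) (at level 70, no associativity) : mv_scope.

Definition is_meet (A : mvAlgebra) (x y m : A) : Prop :=
  [/\ m ≤ x, m ≤ y & forall z : A, z ≤ x -> z ≤ y -> z ≤ m].

Record is_MVWrig (A : mvAlgebra) (mul : A -> A -> A) : Prop := IsMVWrig {
  mvw_mulA : forall a b c, mul a (mul b c) = mul (mul a b) c;
  mvw_mulC : forall a b, mul a b = mul b a;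
  mvw_mulx0 : forall a, mul a 0 = 0;
  mvw_mul0x : forall a, mul 0 a = 0;
  mvw_mul_add : forall a b c, mul a (b ⊕ c) ≤ mul a b ⊕ mul a c;
  mvw_mul_sub : forall a b c, mul a b ⊖ mul a c ≤ mul a (b ⊖ c) }.

Lemma mv_leE (A : mvAlgebra) (x y : A) : x ≤ y <-> ¬ x ⊕ y = ¬ 0.
Proof.
rewrite /mv_le /mv_sub; split=> [<-|->]; by rewrite mv_negK.
Qed.

Lemma mv_addNx (A : mvAlgebra) (x : A) : ¬ x ⊕ x = ¬ 0.
Proof.
have := mv_lukasiewicz x (¬ 0).
by rewrite !mv_addx1 mv_negK [0 ⊕ x]mv_addC mv_addx0 => <-.
Qed.

Lemma mv_le_subK (A : mvAlgebra) (x y : A) : x ≤ y -> y ⊖ x ⊕ x = y.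
Proof.
move=> /mv_leE xy; rewrite /mv_sub mv_lukasiewicz xy mv_negK.
by rewrite mv_addC mv_addx0.
Qed.

Lemma mv_le_anti (A : mvAlgebra) (x y : A) : x ≤ y -> y ≤ x -> x = y.
Proof.
move=> /mv_le_subK xy yx.
by rewrite -xy yx mv_addC mv_addx0.
Qed.

Lemma is_meet_formula (A : mvAlgebra) (x y : A) : is_meet x y (x ⊖ (x ⊖ y)).
Proof.
have lbl (u v : A) : ¬ (¬ (u ⊕ ¬ v) ⊕ ¬ v) ≤ v.
  by apply/mv_leE; rewrite mv_negK -mv_addA mv_addNx mv_addx1.
have E : x ⊖ (x ⊖ y) = ¬ (¬ (y ⊕ ¬ x) ⊕ ¬ x).
  by rewrite /mv_sub [¬ x ⊕ ¬ _]mv_addC [y ⊕ _]mv_addC.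
have E' : x ⊖ (x ⊖ y) = ¬ (¬ (x ⊕ ¬ y) ⊕ ¬ y).
  by rewrite E -{1}[y]mv_negK mv_lukasiewicz mv_negK.
split; [by rewrite E; apply: lbl | by rewrite E'; apply: lbl | move=> z zx zy].
have nle (u v : A) : u ≤ v -> ¬ v ≤ ¬ u.
  by move=> /mv_leE uv; apply/mv_leE; rewrite mv_negK mv_addC.
apply/mv_leE; rewrite E'.
set w := ¬ z ⊖ ¬ y; have zE : w ⊕ ¬ y = ¬ z by apply: mv_le_subK; apply: nle.
have xw : ¬ (x ⊕ ¬ y) ≤ w.
  apply/mv_leE; rewrite mv_negK -mv_addA [¬ y ⊕ w]mv_addC zE mv_addC.
  exact/mv_leE.
rewrite -zE -(mv_le_subK xw) -!mv_addA.
by rewrite [_ ⊕ (¬ y ⊕ _)]mv_addA [_ ⊕ ¬ (_ ⊕ _)]mv_addC mv_addNx mv_addx1.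
Qed.

Lemma is_meet_unique (A : mvAlgebra) (x y m n : A) :
  is_meet x y m -> is_meet x y n -> m = n.
Proof. by move=> [mx my mP] [nx ny nP]; apply: mv_le_anti; auto. Qed.

(* Main.v *)
Require Import Defs.
From mathcomp Require Import ssreflect ssrfun ssrbool.

(** The whole argument rests on residuation: [x ⊖ y ≤ z] holds exactly when
    [x ≤ y ⊕ z] ([mv_le_subl]). Thus adding [x] is an upper adjoint of
    subtracting [x], and so preserves meets ([mv_le_add_meet]). Write [∧] for
    the product given by the meet.

    - Subadditivity: expand [(a ∧ b) ⊕ (a ∧ c)] twice as a meet of sums. The
      element [a ∧ (b ⊕ c)] lies below [a], hence below every sum that has [a]
      as a summand, and the only remaining sum is [b ⊕ c].
    - Subtraction: [(a ∧ b) ⊖ (a ∧ c)] is below [a ∧ b], hence below [a]. By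
      residuation it is below [b ⊖ c] as soon as
      [a ∧ b ≤ (a ∧ c) ⊕ (b ⊖ c)], and the right-hand side is again a meet of
      sums: one has [a] as a summand and the other, [c ⊕ (b ⊖ c)], is above
      [b].

    The monoid and zero laws hold for the meet in any order with least
    element [0]. *)

Set Implicit Arguments.
Unset Strict Implicit.
Unset Printing Implicit Defensive.

Local Open Scope mv_scope.

Section Order.

Variable A : mvAlgebra.
Implicit Types x y z t m : A.

Lemma mv_le_refl x : x ≤ x.
Proof. by apply/mv_leE; apply: mv_addNx. Qed.

(** A larger element is a sum with the smaller one as a summand, and adding
    to the top element does not change it. *)
Lemma mv_le_trans y x z : x ≤ y -> y ≤ z -> x ≤ z.
Proof.
move=> /mv_leE xy /mv_le_subK <-; apply/mv_leE.
by rewrite [_ ⊕ y]mv_addC mv_addA xy mv_addC mv_addx1.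
Qed.

Lemma mv_le0x x : 0 ≤ x.
Proof. by apply/mv_leE; rewrite mv_addC mv_addx1. Qed.

(** Residuation: both sides say that [¬ x ⊕ y ⊕ z] is the top element. *)
Lemma mv_le_subl x y z : x ⊖ y ≤ z <-> x ≤ y ⊕ z.
Proof.
by split=> /mv_leE h; apply/mv_leE; move: h; rewrite /mv_sub mv_negK mv_addA.
Qed.

Lemma mv_le_addr x y : x ≤ x ⊕ y.
Proof. by apply/mv_leE; rewrite mv_addA mv_addNx mv_addC mv_addx1. Qed.

Lemma mv_le_sub x y : x ⊖ y ≤ x.
Proof. by apply/mv_le_subl; rewrite mv_addC; apply: mv_le_addr. Qed.

Lemma mv_le_addB x y : x ≤ y ⊕ (x ⊖ y).
Proof. by apply/mv_le_subl; apply: mv_le_refl. Qed.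

(** An upper adjoint preserves meets: the hypotheses say that [t ⊖ x] is a
    lower bound of [y] and [z]. *)
Lemma mv_le_add_meet x y z m t :
  is_meet y z m -> t ≤ x ⊕ y -> t ≤ x ⊕ z -> t ≤ x ⊕ m.
Proof. by move=> [_ _ mP] /mv_le_subl ty /mv_le_subl tz; apply/mv_le_subl/mP. Qed.

End Order.

Theorem proposition3p1 (A : mvAlgebra) (mul : A -> A -> A)
  (mul_meet : forall x y : A, is_meet x y (mul x y)) : is_MVWrig mul.
Proof.
have mulL x y : mul x y ≤ x by case: (mul_meet x y).
have mulR x y : mul x y ≤ y by case: (mul_meet x y).
have mulP z x y : z ≤ x -> z ≤ y -> z ≤ mul x y.
  by case: (mul_meet x y) => _ _; apply.
split.
- move=> a b c; apply: mv_le_anti.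
  + have bc := mulR a (mul b c).
    apply: (mulP); first apply: (mulP); first exact: mulL.
      exact: mv_le_trans bc (mulL _ _).
    exact: mv_le_trans bc (mulR _ _).
  + have ab := mulL (mul a b) c.
    apply: (mulP); first exact: mv_le_trans ab (mulL _ _).
    by apply: (mulP); [exact: mv_le_trans ab (mulR _ _) | exact: mulR].
- by move=> a b; apply: mv_le_anti; apply: (mulP).
- by move=> a; apply: mv_le_anti; [exact: mulR | exact: mv_le0x].
- by move=> a; apply: mv_le_anti; [exact: mulL | exact: mv_le0x].
- move=> a b c.
  have ta (z : A) : mul a (b ⊕ c) ≤ a ⊕ z.
    exact: mv_le_trans (mulL _ _) (mv_le_addr _ _).
  apply: mv_le_add_meet (mul_meet a c) _ _; first by rewrite [_ ⊕ a]mv_addC.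
  rewrite [mul a b ⊕ c]mv_addC; apply: mv_le_add_meet (mul_meet a b) _ _.
    by rewrite [c ⊕ a]mv_addC.
  by rewrite [c ⊕ b]mv_addC; apply: mulR.
- move=> a b c; apply: (mulP).
    exact: mv_le_trans (mv_le_sub _ _) (mulL _ _).
  apply/mv_le_subl; rewrite mv_addC; apply: mv_le_add_meet (mul_meet a c) _ _.
    rewrite mv_addC; exact: mv_le_trans (mulL _ _) (mv_le_addr _ _).
  rewrite mv_addC; exact: mv_le_trans (mulR _ _) (mv_le_addB _ _).
Qed.
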